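(* Let $a<b$ be real numbers and let $f:[a,b]\to\mathbb{R}$ be an absolutely continuous function such that $f'\in L_2(a,b)$. Then $$|Q(f;a,b)|\le\sqrt{\frac{11}{96}-\frac{\sqrt2}{16}}\;\sigma(f';a,b)\,(b-a)^{3/2}.$$ This inequality is sharp in the sense that the constant $\sqrt{\frac{11}{96}-\frac{\sqrt2}{16}}$ cannot be replaced by a smaller one (i.e. by a smaller constant for which the inequality would still hold for all such $f$).
   Context: For $f$ on $[a,b]$, $$Q(f;a,b)=\int_a^b f(t)\,dt-\left[\frac{\sqrt2}{8}f(a)+\left(1-\frac{\sqrt2}{4}\right)f\left(\frac{a+b}{2}\right)+\frac{\sqrt2}{8}f(b)\right](b-a).$$ For real-valued $g\in L_2(a,b)$, $\sigma(g;a,b)=\sqrt{(b-a)\,T(g,g)}$, where $T(g,g)=\frac1{b-a}\int_a^b g(t)^2\,dt-\left(\frac1{b-a}\int_a^b g(t)\,dt\right)^2$. *)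

(* Defs.v *)
From HB Require Import structures.
From mathcomp Require Import all_boot all_order all_algebra.
From mathcomp Require Import all_classical all_reals all_analysis.
Import Order.TTheory GRing.Theory Num.Theory.
Import numFieldNormedType.Exports.

Set Implicit Arguments.
Unset Strict Implicit.
Unset Printing Implicit Defensive.

Local Open Scope classical_set_scope.
Local Open Scope ring_scope.

(* A function on [a, b] is represented by a total function R -> R of which
   only the values on [a, b] are constrained or used. *)

Definition abs_continuous (R : realType) (a b : R) (f : R -> R) : Prop :=
  forall e : R, 0 < e -> exists2 d : R, 0 < d &
    forall (n : nat) (u v : 'I_n -> R),
      (forall i, [/\ a <= u i, u i < v i & v i <= b]) ->
      trivIset [set: 'I_n] (fun i => `]u i, v i[%classic) ->
      \sum_(i < n) (v i - u i) < d ->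
      \sum_(i < n) `|f (v i) - f (u i)| < e.

(* Membership in L_2(a, b), through the extension of g by 0 outside ]a, b[. *)
Definition L2_on (R : realType) (a b : R) (g : R -> R) : Prop :=
  ((g \_ `]a, b[%classic) : R -> R) \in Lfun (@lebesgue_measure R) 2%:E.

Definition Q (R : realType) (f : R -> R) (a b : R) : R :=
  (\int[@lebesgue_measure R]_(t in `[a, b]) f t)
  - (Num.sqrt 2 / 8 * f a
     + (1 - Num.sqrt 2 / 4) * f ((a + b) / 2)
     + Num.sqrt 2 / 8 * f b) * (b - a).

(* This is T(g, g). For g = derive1 f, integrating over the open interval makes
   every value of g used depend on f restricted to [a, b] only; where f is not
   differentiable (a null set if f is absolutely continuous) derive1 f takes a
   default value. *)
Definition T_diag (R : realType) (g : R -> R) (a b : R) : R :=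
  (b - a)^-1 * (\int[@lebesgue_measure R]_(t in `]a, b[) (g t ^+ 2))
  - ((b - a)^-1 * (\int[@lebesgue_measure R]_(t in `]a, b[) g t)) ^+ 2.

Definition sigma (R : realType) (g : R -> R) (a b : R) : R :=
  Num.sqrt ((b - a) * T_diag g a b).

(* Main.v *)
Require Import Defs.
From HB Require Import structures.
From mathcomp Require Import all_boot all_order all_algebra.
From mathcomp Require Import all_classical all_reals all_analysis.
From mathcomp Require Import measurable_realfun ring lra.
Import Order.TTheory GRing.Theory Num.Theory.
Import numFieldNormedType.Exports.

Local Open Scope classical_set_scope.
Local Open Scope ring_scope.

Set Implicit Arguments.
Unset Strict Implicit.

(** Up to sign, the quadrature error is a pairing with the derivative. Integration
    by parts on each half of [a, b] gives [Q f a b = - \int K * f'], where the Peano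
    kernel [K] is affine of slope 1 on each half, with a jump at the midpoint, and
    vanishes at distance [Num.sqrt 2 / 8 * (b - a)] from each endpoint
    ([Q_kernel]). The kernel is antisymmetric about the midpoint, so its integral is
    zero and [f'] may be replaced by [f'] minus its mean value. The Cauchy-Schwarz
    inequality ([centered_cauchy_schwarz]) then bounds the error by the product of
    the L2 norm of [K], whose square is [(11 / 96 - Num.sqrt 2 / 16) * (b - a) ^+ 3]
    ([integral_peano_kernel_sqr]), and of the L2 norm of the centered [f'], which is
    [sigma f' a b]. Equality holds when [f'] is proportional to [K], so a primitive
    of [K], which is piecewise quadratic, shows that the constant is sharp
    ([Q_extremal_le]).

    The analytic substance is the integration by parts for a function that is only
    absolutely continuous. It follows from the fundamental theorem of calculus for
    such functions ([ac_ftc]): they are differentiable almost everywhere and they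
    are the integral of their derivative. That theorem is proved with measures. The
    total variation [tv a f] of an absolutely continuous [f] is finite and again
    absolutely continuous ([tv_ac]), so [f] is a difference of two nondecreasing
    absolutely continuous functions. The Lebesgue-Stieltjes measure of each of them
    vanishes on Lebesgue-null sets, so it has a Radon-Nikodym density
    ([stieltjes_density]); hence [f] is the indefinite integral of an integrable
    function, and the Lebesgue differentiation theorem identifies that function with
    the derivative of [f] at almost every point. *)

(** * Absolute continuity over finite lists of segments *)

Section AbsoluteContinuity.
Context {R : realType}.
Implicit Types (a b x y e d : R) (f : R -> R) (p q : R * R) (s t : seq (R * R)).

(** The pair [p] stands for the segment [p.1, p.2]; two segments that only share
    an endpoint do not overlap. *)
Definition nonoverlap p q := (p.2 <= q.1) || (q.2 <= p.1).

Definition seg_in a b p := [&& a <= p.1, p.1 <= p.2 & p.2 <= b].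

Definition nonoverlap_in a b s := all (seg_in a b) s && pairwise nonoverlap s.

Definition total_length s := \sum_(p <- s) (p.2 - p.1).

Definition jumps f s := \sum_(p <- s) `|f p.2 - f p.1|.

(** Absolute continuity over lists of possibly degenerate segments: lists can be
    concatenated, filtered and mapped without reindexing, and the large
    inequality on [jumps f s] survives the suprema that define the total
    variation. *)
Definition ac a b f := forall e, 0 < e -> exists2 d, 0 < d &
  forall s, nonoverlap_in a b s -> total_length s < d -> jumps f s <= e.

Lemma nonoverlapC : symmetric nonoverlap.
Proof. by move=> p q; rewrite /nonoverlap orbC. Qed.

Lemma nonoverlap_sub p q p' : p.1 <= p'.1 -> p'.2 <= p.2 ->
  nonoverlap p q -> nonoverlap p' q.
Proof.
rewrite /nonoverlap => h1 h2 /orP[h|h]; apply/orP; [left|right].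
  exact: le_trans h.
exact: le_trans h1.
Qed.

(** A degenerate segment contributes neither length nor jump, so the list may be
    filtered down to its proper segments, which are then indexed by position. *)
Lemma abs_continuous_ac a b f : abs_continuous a b f -> ac a b f.
Proof.
move=> acf e /acf[d d0 fd]; exists d => // s /andP[sin ssep] sd.
pose s' := [seq p <- s | p.1 < p.2].
have drop (F : R * R -> R) : (forall p, p.1 = p.2 -> F p = 0) ->
    \sum_(p <- s) F p = \sum_(i < size s') F (nth (0, 0) s' i).
  move=> F0; transitivity (\sum_(p <- s') F p); last by rewrite (big_nth (0, 0)) big_mkord.
  rewrite big_filter [RHS]big_mkcond /=.
  rewrite big_seq [RHS]big_seq; apply: eq_bigr => p /(allP sin)/and3P[_ + _].
  by rewrite le_eqVlt => /predU1P[/[dup] pE /F0 ->|->//]; rewrite pE ltxx.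
have s'in (i : 'I_(size s')) : nth (0, 0) s' i \in s'.
  exact: mem_nth.
apply/ltW.
rewrite /jumps (drop (fun p => `|f p.2 - f p.1|)); last first.
  by move=> p ->; rewrite subrr normr0.
apply: (fd _ (fun i => (nth (0, 0) s' i).1) (fun i => (nth (0, 0) s' i).2)).
- move=> i; have := s'in i; rewrite mem_filter => /andP[lt12 /(allP sin)].
  by case/and3P.
- have /pairwiseP - /(_ (0, 0)) sep : pairwise nonoverlap s'.
    exact: pairwise_filter.
  have main (i j : 'I_(size s')) :
     nonoverlap (nth (0, 0) s' i) (nth (0, 0) s' j) ->
     `](nth (0, 0) s' i).1, (nth (0, 0) s' i).2[%classic `&`
     `](nth (0, 0) s' j).1, (nth (0, 0) s' j).2[%classic !=set0 -> False.
    move=> sij [x [/=]]; rewrite !in_itv/= => /andP[x1 x2] /andP[x3 x4].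
    case/orP: sij => h.
      by have := lt_trans x3 (lt_le_trans x2 h); rewrite ltxx.
    by have := lt_trans x1 (lt_le_trans x4 h); rewrite ltxx.
  move=> i j _ _ ne; apply: contrapT => /eqP; rewrite -val_eqE /= neq_ltn.
  move=> /orP[ij|ij].
    by apply: (main i j) ne; apply: sep => //; rewrite inE.
  by apply: (main j i); [apply: sep => //; rewrite inE|rewrite setIC].
- by rewrite -(drop (fun p => p.2 - p.1)) // => p ->; rewrite subrr.
Qed.

Lemma lipschitz_abs_continuous a b f (L : R) :
  (forall x y, a <= x -> x <= y -> y <= b -> `|f y - f x| <= L * (y - x)) ->
  abs_continuous a b f.
Proof.
move=> Lf e e0; exists (e / (`|L| + 1)); first by rewrite divr_gt0// ltr_wpDl.
move=> n u v uv _ uvd.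
apply: (@le_lt_trans _ _ ((`|L| + 1) * \sum_(i < n) (v i - u i))); last first.
  by rewrite mulrC -ltr_pdivlMr// ltr_wpDl.
rewrite mulr_sumr; apply: ler_sum => i _; have [au /ltW uvi vb] := uv i.
apply: le_trans (Lf _ _ au uvi vb) _.
by rewrite ler_wpM2r ?subr_ge0// (le_trans (ler_norm _))// lerDl.
Qed.

Lemma lipschitz_ac a b f (L : R) :
  (forall x y, a <= x -> x <= y -> y <= b -> `|f y - f x| <= L * (y - x)) ->
  ac a b f.
Proof. by move=> /lipschitz_abs_continuous; exact: abs_continuous_ac. Qed.

Definition clamp a b x := Num.max a (Num.min b x).

Lemma clamp_itv a b x : a <= b -> a <= clamp a b x <= b.
Proof. by move=> ab; rewrite /clamp le_max lexx/= ge_max ab ge_min lexx. Qed.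

Lemma clamp_id a b x : a <= x -> x <= b -> clamp a b x = x.
Proof. by move=> ax xb; rewrite /clamp (min_idPr xb) (max_idPr ax). Qed.

Lemma le_clamp a b : {homo clamp a b : x y / x <= y}.
Proof.
move=> x y xy; rewrite /clamp ge_max le_max lexx/= le_max le_min !ge_min lexx xy.
by rewrite /= !orbT.
Qed.

Lemma clamp_contract a b x y : x <= y -> clamp a b y - clamp a b x <= y - x.
Proof.
move=> xy; rewrite /clamp.
by case: (leP b x) => ?; case: (leP b y) => ?;
   do ! (case: (leP a _) => ? //; try lra).
Qed.

(** The clamped function is the extension by constants to the whole line, on which
    Stieltjes measures are built. Clamping is nondecreasing and contracting, so it
    maps admissible lists to admissible lists that are no longer. *)
Lemma ac_clamp a b a' b' f : a <= b -> ac a b f -> ac a' b' (f \o clamp a b).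
Proof.
move=> ab acf e /acf[d d0 fd]; exists d => // s /andP[/allP sin ssep] sd.
pose c p := (clamp a b p.1, clamp a b p.2).
have -> : jumps (f \o clamp a b) s = jumps f (map c s) by rewrite /jumps big_map.
apply: fd.
  apply/andP; split.
    apply/allP => _ /mapP[p /sin/and3P[_ p12 _] ->]; rewrite /seg_in /=.
    by rewrite le_clamp//; have /andP[-> _] := clamp_itv p.1 ab;
       have /andP[_ ->] := clamp_itv p.2 ab.
  rewrite pairwise_map; apply: sub_pairwise ssep => p q /=.
  by rewrite /nonoverlap/= => /orP[h|h]; apply/orP; [left|right]; exact: le_clamp.
apply: le_lt_trans sd; rewrite /total_length big_map big_seq [leRHS]big_seq.
by apply: ler_sum => p /sin/and3P[_ ? _]; exact: clamp_contract.
Qed.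

Lemma ac_modulus a b f e : ac a b f -> 0 < e -> exists2 d, 0 < d &
  forall x y, a <= x -> x <= y -> y <= b -> y - x < d -> `|f y - f x| <= e.
Proof.
move=> acf /acf[d d0 fd]; exists d => // x y ax xy yb yxd.
have := fd [:: (x, y)]; rewrite /jumps /total_length !big_seq1 /=.
by apply => //; rewrite /nonoverlap_in /seg_in /= ax xy yb.
Qed.

Lemma continuous_ac_clamp a b f : a <= b -> ac a b f ->
  continuous (f \o clamp a b).
Proof.
move=> ab acf x; apply/cvgrPdist_le => e e0.
have [d d0 fd] := ac_modulus acf e0.
near=> y.
have xyd : `|x - y| < d by near: y; exact: cvgr_dist_lt.
have inab z : a <= clamp a b z /\ clamp a b z <= b.
  by apply/andP; exact: clamp_itv.
have [xy|/ltW yx] := leP x y.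
  rewrite distrC; apply: fd; [exact: (inab x).1|exact: le_clamp|exact: (inab y).2|].
  apply: le_lt_trans (clamp_contract _ _ xy) _.
  by apply: le_lt_trans xyd; rewrite distrC ler_norm.
apply: fd; [exact: (inab y).1|exact: le_clamp|exact: (inab x).2|].
apply: le_lt_trans (clamp_contract _ _ yx) _.
by apply: le_lt_trans xyd; rewrite ler_norm.
Unshelve. all: by end_near. Qed.

End AbsoluteContinuity.

(** * Total variation of an absolutely continuous function *)

Section TotalVariation.
Context {R : realType}.
Implicit Types (a b x y e d : R) (f : R -> R) (p q : R * R) (s t u : seq (R * R)) (r : seq R).

Local Notation TV := total_variation.

Definition pieces x (r : seq R) := zip (x :: r) r.

Lemma variation_pieces x y f r : itv_partition x y r ->
  variation x y f r = jumps f (pieces x r).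
Proof.
move=> xys; rewrite variation_zip// /jumps /pieces.
elim: r x {xys} => [|z r IHs] x; first by rewrite !big_nil.
by rewrite /= !big_cons /= IHs.
Qed.

Lemma piecesP x y r : itv_partition x y r ->
  nonoverlap_in x y (pieces x r) /\ total_length (pieces x r) = y - x.
Proof.
rewrite /total_length /pieces.
elim: r x => [|z r IHs] x xys.
  by rewrite /= big_nil (itv_partition_nil xys) subrr.
have xz : x <= z by case: xys => /= /andP[/ltW].
have zys := itv_partition_cons xys.
have zy := itv_partition_le zys.
have [/andP[sin ssep] slen] := IHs _ zys.
rewrite big_cons slen /=; split; last by rewrite addrC subrKA.
apply/andP; split => /=.
  rewrite /seg_in /= lexx xz zy /=; apply: sub_all sin => p /and3P[zp p12 py].
  by apply/and3P; split => //; exact: le_trans zp.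
rewrite ssep andbT; apply: sub_all sin => p /and3P[zp _ _].
by rewrite /nonoverlap /= zp.
Qed.

Lemma total_length_cat s t :
  total_length (s ++ t) = total_length s + total_length t.
Proof. by rewrite /total_length big_cat. Qed.

Lemma jumps_cat f s t : jumps f (s ++ t) = jumps f s + jumps f t.
Proof. by rewrite /jumps big_cat. Qed.

Lemma nonoverlap_in_catCA a b s t u :
  nonoverlap_in a b (s ++ t ++ u) = nonoverlap_in a b (t ++ s ++ u).
Proof.
rewrite /nonoverlap_in !all_cat andbCA; congr (_ && _).
rewrite !pairwise_cat !allrel_catr [allrel nonoverlap s t]allrelC.
rewrite (eq_allrel (r' := nonoverlap)) => [|p q]; last exact: nonoverlapC.
by case: (allrel _ t s); case: (allrel _ s u); case: (allrel _ t u);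
   case: (pairwise _ s); case: (pairwise _ t); case: (pairwise _ u).
Qed.

Lemma nonoverlap_in_refine a b p s t : nonoverlap_in a b (p :: s) ->
  nonoverlap_in p.1 p.2 t -> nonoverlap_in a b (t ++ s).
Proof.
move=> /andP[/= /andP[/and3P[ap p12 pb] sin] /andP[ps ssep]] /andP[tin tsep].
apply/andP; split.
  rewrite all_cat sin andbT; apply: sub_all tin => q /and3P[pq q12 qp].
  by apply/and3P; split => //; [exact: le_trans pq|exact: le_trans pb].
rewrite pairwise_cat tsep ssep !andbT; apply/allrelP => q r qt rs.
have /and3P[pq _ qp] := allP tin _ qt.
by apply: nonoverlap_sub (allP ps _ rs).
Qed.

(** Total variations of non-overlapping segments obey the same bound as jumps. The
    segments of [s] are treated one at a time: for each partition of the first one,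
    its pieces join the list [t] of segments on which plain jumps are counted, the
    induction hypothesis applies, and the supremum over partitions is taken. The
    list [t] is there to make this induction possible. *)
Lemma TV_jumps_le a b f e d :
  (forall s, nonoverlap_in a b s -> total_length s < d -> jumps f s <= e) ->
  forall s t, nonoverlap_in a b (s ++ t) -> total_length (s ++ t) < d ->
  (\sum_(p <- s) TV p.1 p.2 f + (jumps f t)%:E <= e%:E)%E.
Proof.
move=> fe; elim=> [|p s IHs] t st dst; first by rewrite big_nil add0e lee_fin fe.
have ge0 q : q \in s -> (0 <= TV q.1 q.2 f)%E.
  move=> qs; apply: total_variation_ge0.
  have /andP[/allP/(_ q)] := st.
  by rewrite mem_cat inE qs orbT => /(_ isT)/and3P[].
have p12 : p.1 <= p.2 by case/andP: st => /= /andP[/and3P[]].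
have refine u : nonoverlap_in p.1 p.2 u -> total_length u = p.2 - p.1 ->
    (\sum_(q <- s) TV q.1 q.2 f + (jumps f u)%:E + (jumps f t)%:E <= e%:E)%E.
  move=> up ul; rewrite -addeA -EFinD -jumps_cat; apply: IHs.
    by rewrite nonoverlap_in_catCA; exact: nonoverlap_in_refine up.
  move: dst; rewrite /= -cat1s !total_length_cat ul.
  by rewrite /total_length !big_seq1 addrCA.
(* Needed to move the sum across the inequality before taking the supremum. *)
have S_fin : (\sum_(q <- s) TV q.1 q.2 f \is a fin_num)%E.
  have S0 : (0 <= \sum_(q <- s) TV q.1 q.2 f)%E.
    by rewrite big_seq sume_ge0// => q /ge0.
  rewrite ge0_fin_numE //.
  have := refine [:: p]; rewrite /nonoverlap_in /total_length /seg_in /= big_seq1.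
  rewrite !lexx p12 => /(_ isT erefl) h.
  apply: (@le_lt_trans _ _ e%:E); last exact: ltry.
  by apply: le_trans h; rewrite -addeA leeDl// lee_fin addr_ge0 // sumr_ge0.
rewrite big_cons addeAC -addeA -leeBrDr ?fin_numD ?S_fin//.
apply: ge_ereal_sup => _ /= [_ [u pu <-] <-].
have [upin ulen] := piecesP pu.
rewrite (variation_pieces _ pu) leeBrDr ?fin_numD ?S_fin//.
by rewrite addeA addeAC (addeC _%:E) refine.
Qed.

Section ac.
Variables (a b : R) (f : R -> R).
Hypothesis acf : ac a b f.

(** A segment shorter than the modulus [d] of absolute continuity for [e = 1] has
    total variation at most 1, and finitely many of them cover [x, y]. *)
Lemma ac_TV_fin x y : a <= x -> x <= y -> y <= b -> TV x y f \is a fin_num.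
Proof.
have [d d0 fd] := acf ltr01.
have [n] : exists n, (y - x) / (d / 2) < n%:R.
  by exists (Num.truncn ((y - x) / (d / 2))).+1; exact: truncnS_gt.
rewrite ltr_pdivrMr ?divr_gt0 // => xyn.
(* Segments of length d / 2 are peeled off from the left. *)
elim: n x xyn => [|n IHn] x xyn ax xy yb.
  by rewrite mul0r ltNge subr_ge0 xy in xyn.
have small (u v : R) : a <= u -> u <= v -> v <= b -> v - u < d ->
    TV u v f \is a fin_num.
  move=> au uv vb uvd; rewrite ge0_fin_numE ?total_variation_ge0 //.
  have := TV_jumps_le fd (s := [:: (u, v)]) (t := [::]).
  rewrite /nonoverlap_in /seg_in /total_length /= au uv vb !big_seq1 /jumps big_nil.
  rewrite adde0 => /(_ isT uvd) h; apply: le_lt_trans h _; exact: ltry.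
have [xyd|dxy] := ltP (y - x) d; first exact: small.
rewrite (@total_variationD _ _ _ (x + d / 2)); [|lra..].
rewrite fin_numD small /=; [|lra..].
apply: IHn; [|lra..].
by move: xyn; rewrite mulrSr mulrDl mul1r; lra.
Qed.

Definition tv x := fine (TV a x f).

Lemma tvB x y : a <= x -> x <= y -> y <= b -> (tv y - tv x)%:E = TV x y f.
Proof.
move=> ax xy yb; rewrite EFinB /tv !fineK ?ac_TV_fin//; first last.
- exact: le_trans xy.
- exact: le_trans yb.
- by rewrite (total_variationD f ax xy) addeAC subee ?add0e // ac_TV_fin // (le_trans xy).
Qed.

(** This makes both [tv] and [tv \- f] nondecreasing: the Jordan decomposition. *)
Lemma tv_jump x y : a <= x -> x <= y -> y <= b -> `|f y - f x| <= tv y - tv x.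
Proof.
by move=> ax xy yb; rewrite -lee_fin tvB// total_variation_ge.
Qed.

Lemma tv_ac : ac a b tv.
Proof.
move=> e /acf[d d0 fd]; exists d => // s ssep sd.
have := TV_jumps_le fd (s := s) (t := [::]); rewrite cats0 => /(_ ssep sd).
rewrite /jumps big_nil adde0 -lee_fin; apply: le_trans.
rewrite -sumEFin big_seq [leRHS]big_seq; apply: lee_sum => p ps.
case/andP: ssep => /allP/(_ _ ps)/and3P[ap p12 pb] _.
rewrite -tvB// lee_fin ger0_norm// (le_trans _ (tv_jump ap p12 pb))//.
Qed.

End ac.
End TotalVariation.

(** * The Stieltjes measure of a nondecreasing absolutely continuous function *)

Section StieltjesDensity.
Context {R : realType}.

Local Notation mu := (@lebesgue_measure R).

Lemma disjoint_itv_nonoverlap (u v u' v' : R) : u < v -> u' < v' ->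
  `]u, v[%classic `&` `]u', v'[%classic = set0 -> nonoverlap (u, v) (u', v').
Proof.
move=> uv uv' uvuv'; rewrite /nonoverlap /=.
have [//|u'v] := leP v u'; have [//|uv'' /=] := leP v' u.
have lt : Num.max u u' < Num.min v v'.
  by rewrite gt_max !lt_min uv u'v uv'' uv'.
have : (`]u, v[%classic `&` `]u', v'[%classic)
    ((Num.max u u' + Num.min v v') / 2).
  have [] := midf_lt lt; rewrite gt_max lt_min => /andP[h1 h2] /andP[h3 h4].
  by split; rewrite /= in_itv /= ?h1 ?h2 ?h3 ?h4.
by rewrite uvuv'.
Qed.

Variables (a b : R) (G : R -> R).
Hypotheses (ndG : {homo G : x y / x <= y}) (cG : continuous G).
Hypothesis acG : ac a b G.

HB.instance Definition _ :=
  isCumulative.Build R _ R G ndG (right_continuousW cG).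

Let lsG := lebesgue_stieltjes_measure G.

Let lsG_oc x y : x <= y -> lsG `]x, y]%classic = (G y - G x)%:E.
Proof.
move=> xy; rewrite /lsG /lebesgue_stieltjes_measure /measure_extension.
rewrite measurable_mu_extE/= ?wlength_itv_bnd//; last exact: is_ocitv.
Qed.

Let mD : measurable (`]a, b[%classic : set (measurableTypeR R)).
Proof. exact: measurable_itv. Qed.

Let lsG_oo x y : x <= y -> (lsG `]x, y[%classic <= (G y - G x)%:E)%E.
Proof.
move=> xy; rewrite -lsG_oc//; apply: le_measure; rewrite ?inE.
- exact: measurable_itv.
- exact: measurable_itv.
- exact: subset_itvW.
Qed.

Let fin_D : (lsG `]a, b[%classic < +oo)%E.
Proof.
have [ab|ba] := leP a b; first exact: le_lt_trans (lsG_oo ab) (ltry _).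
by rewrite set_itv_ge ?bnd_simp -?leNgt ?ltW // [lsG _]measure0.
Qed.

(** [W] is a disjoint union of countably many open intervals. By the hypothesis on
    [d], [G] grows by at most [e] over any finitely many of them, and the measure of
    [W] is the limit of these finite sums. *)
Let lsG_open_le e d (W : set R) : open W -> W `<=` `]a, b[%classic ->
  (forall s, nonoverlap_in a b s -> total_length s < d -> jumps G s <= e) ->
  (mu W < d%:E)%E -> (lsG W <= e%:E)%E.
Proof.
move=> oW Wab Gde Wd.
have [I [Io Itriv WE]] := OpenSetDisjointItvs.open_disjoint_itv oW.
have IW q : I q `<=` W by rewrite WE; exact: bigcup_sup.
have mI q : measurable (I q : set (measurableTypeR R)).
  by apply: open_measurable; exact: (Io q).1.
have mW : measurable (\bigcup_q I q : set (measurableTypeR R)).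
  exact: bigcup_measurable.
have IE q : I q !=set0 -> [/\ a <= inf (I q), inf (I q) < sup (I q),
    sup (I q) <= b & I q = `]inf (I q), sup (I q)[%classic].
  move=> I0; have lbI : lbound (I q) a.
    by move=> x /IW/Wab/=; rewrite in_itv => /andP[/ltW].
  have ubI : ubound (I q) b.
    by move=> x /IW/Wab/=; rewrite in_itv => /andP[_ /ltW].
  have E : I q = `]inf (I q), sup (I q)[%classic.
    have {1}<- : (I q)°%classic = I q by apply: (interior_id _).1; exact: (Io q).1.
    rewrite interval_bounded_interior; [|exact: (Io q).2|by exists a|by exists b].
    by apply/seteqP; split=> x /=; rewrite in_itv.
  split => //; first exact: lb_le_inf.
    by have [x] := I0; rewrite {1}E/= in_itv/= => /andP[]; exact: lt_trans.
  exact: ge_sup.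
have cvg_lsG := @measure_semi_sigma_additive _ _ _ lsG I mI Itriv mW.
have cvg_mu := @measure_semi_sigma_additive _ _ _ mu I mI Itriv mW.
rewrite WE; apply: (cvge_to_le cvg_lsG); apply: nearW => n.
(* Empty components are left out: inf and sup are meaningless for them. *)
pose s := [seq (inf (I q), sup (I q)) | q <- iota 0 n & I q != set0].
have sumE (F : set R -> \bar R) : F set0 = 0%E ->
    (\sum_(0 <= q < n) F (I q) = \sum_(q <- iota 0 n | I q != set0) F (I q))%E.
  move=> F0; rewrite [RHS]big_mkcond /= /index_iota subn0.
  by apply: eq_bigr => q _; case: eqP => //= ->.
rewrite (sumE lsG) ?measure0//.
apply: (@le_trans _ _ (jumps G s)%:E).
  rewrite /jumps big_map big_filter -sumEFin; apply: lee_sum => q /set0P/IE.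
  move=> [_ /ltW lt _ {1}->]; apply: le_trans (lsG_oo lt) _.
  by rewrite lee_fin ler_norm.
rewrite lee_fin; apply: Gde.
  apply/andP; split.
    apply/allP => _ /mapP[q + ->]; rewrite mem_filter => /andP[/set0P/IE + _].
    by rewrite /seg_in/= => -[-> /ltW -> ->].
  rewrite pairwise_map; apply: (@sub_in_pairwise _ [pred q | I q != set0]
      (fun q q' => q != q')).
  - move=> q q' /set0P/IE[_ lt _ qE] /set0P/IE[_ lt' _ qE'] /= qq'.
    apply: disjoint_itv_nonoverlap => //; rewrite -qE -qE'.
    by apply/eqP; apply: contraT => /set0P /(Itriv _ _ Logic.I Logic.I)/eqP; rewrite (negbTE qq').
  - by rewrite filter_all.
  - by rewrite -uniq_pairwise filter_uniq// iota_uniq.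
rewrite -lte_fin; apply: le_lt_trans Wd; rewrite {1}WE.
apply: (@le_trans _ _ (\sum_(0 <= q < n) mu (I q))%E).
  rewrite (sumE mu) ?measure0// /total_length big_map big_filter -sumEFin.
  apply: lee_sum => q /set0P/IE[_ lt _ /=]; move: lt.
  set u := inf _; set v := sup _ => lt ->.
  by rewrite lebesgue_measure_itv /= lte_fin lt.
rewrite measure_semi_bigcup//; apply: nneseries_lim_ge => q _ _.
exact: measure_ge0.
Qed.

Let nu := mfrestr mD fin_D.

(** A Lebesgue-null set lies in open sets of arbitrarily small Lebesgue measure. *)
Let nu_dominated : nu `<< mu.
Proof.
apply/null_content_dominatesP => N mN N0.
apply/eqP; rewrite eq_le measure_ge0 andbT; apply/lee_addgt0Pr => e /acG[d d0 Gd].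
rewrite add0e.
have [|U [oU NU Ud]] := lebesgue_regularity_outer mN _ d0.
  by rewrite [X in (X < _)%E]N0 ltry.
have mU : measurable (U : set (measurableTypeR R)).
  exact: open_measurable.
apply: (@le_trans _ _ (nu U)); first by apply: le_measure; rewrite ?inE.
apply: lsG_open_le Gd _.
- by apply: openI => //; exact: interval_open.
- by move=> x [].
- apply: le_lt_trans Ud.
  have : (mu U <= mu (U `\` N) + mu N)%E.
    rewrite -[in leLHS](setDUK NU) setUC.
    by apply: measureU2 => //; exact: measurableD.
  rewrite N0 adde0; apply: le_trans; apply: le_measure; rewrite ?inE//.
  exact: measurableI mU mD.
Qed.

(** The density is the Radon-Nikodym derivative of the Stieltjes measure of [G],
    restricted to ]a, b[ to make it finite, with respect to Lebesgue measure. *)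
Lemma stieltjes_density : exists2 g : R -> R,
  mu.-integrable setT (EFin \o g) &
  forall x y, a < x -> x <= y -> y < b ->
    G y - G x = \int[mu]_(t in `]x, y]) g t.
Proof.
pose g := Radon_Nikodym (charge_of_finite_measure nu) mu.
have gE : EFin \o (fine \o g) = g.
  by apply/funext => x /=; rewrite fineK// Radon_Nikodym_fin_num.
have ig : mu.-integrable setT g.
  by apply: Radon_Nikodym_integrable; exact: nu_dominated.
exists (fine \o g); first by rewrite gE.
move=> x y ax xy yb; apply: EFin_inj; rewrite -lsG_oc// /Rintegral fineK.
  transitivity (nu `]x, y]%classic).
    rewrite /nu /mfrestr /mrestr setIidl// => z /=.
    rewrite !in_itv/= => /andP[xz zy].
    by rewrite (lt_trans ax xz) (le_lt_trans zy yb).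
  rewrite [LHS](@Radon_Nikodym_integral _ _ _ (charge_of_finite_measure nu) mu)//.
  by apply: eq_integral => t _; rewrite -[RHS]/((EFin \o (fine \o g)) t) gE.
apply: integrable_fin_num => //; rewrite -/(EFin \o (fine \o g)) gE.
by apply: integrableS ig => //; exact: measurable_itv.
Qed.

End StieltjesDensity.

(** * The fundamental theorem of calculus for absolutely continuous functions *)

Section AcDensity.
Context {R : realType}.
Implicit Types (a b x y : R) (f : R -> R).

Local Notation mu := (@lebesgue_measure R).

Lemma acB a b f f' : ac a b f -> ac a b f' -> ac a b (f \- f').
Proof.
move=> acf acf' e e0; have e20 : 0 < e / 2 by rewrite divr_gt0.
have [d d0 fd] := acf _ e20; have [d' d'0 fd'] := acf' _ e20.
exists (Num.min d d'); first by rewrite lt_min d0.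
move=> s sin; rewrite lt_min => /andP[sd sd'].
apply: (@le_trans _ _ (jumps f s + jumps f' s)).
  rewrite /jumps -big_split; apply: ler_sum => p _ /=.
  have -> : f p.2 - f' p.2 - (f p.1 - f' p.1) =
    (f p.2 - f p.1) - (f' p.2 - f' p.1) by ring.
  exact: ler_normB.
by rewrite (splitr e) lerD// ?fd ?fd'.
Qed.

(** The measure of [f], extended by constants, is taken on the larger interval
    ]a - 1, b + 1[, so that the density represents [f] up to the endpoints of
    [a, b]. *)
Lemma ac_nondecreasing_density a b f : a <= b -> ac a b f ->
  {in `[a, b] &, {homo f : x y / x <= y}} ->
  exists2 g : R -> R, mu.-integrable setT (EFin \o g) &
  forall x y, a <= x -> x <= y -> y <= b -> f y - f x = \int[mu]_(t in `]x, y]) g t.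
Proof.
move=> ab acf ndf.
have clampP x : clamp a b x \in `[a, b] by rewrite in_itv /= clamp_itv.
have nd : {homo f \o clamp a b : x y / x <= y}.
  by move=> x y xy; apply: ndf => //; exact: le_clamp.
have [g ig gE] := stieltjes_density nd (continuous_ac_clamp ab acf)
  (@ac_clamp _ a b (a - 1) (b + 1) f ab acf).
exists g => // x y ax xy yb; rewrite -gE//; [|lra..].
by rewrite /= !clamp_id// ?(le_trans ax)// (le_trans xy).
Qed.

(** Jordan decomposition: [f] is the difference of its total variation function [V]
    and of [V \- f], both nondecreasing and absolutely continuous. *)
Lemma ac_density a b f : a <= b -> ac a b f ->
  exists2 g : R -> R, mu.-integrable setT (EFin \o g) &
  forall x y, a <= x -> x <= y -> y <= b -> f y - f x = \int[mu]_(t in `]x, y]) g t.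
Proof.
move=> ab acf; pose V := tv a f.
have tvf x y : a <= x -> x <= y -> y <= b -> `|f y - f x| <= V y - V x.
  exact: tv_jump.
have acV : ac a b V by exact: tv_ac.
have [g ig gE] : exists2 g : R -> R, mu.-integrable setT (EFin \o g) &
    forall x y, a <= x -> x <= y -> y <= b -> V y - V x = \int[mu]_(t in `]x, y]) g t.
  apply: ac_nondecreasing_density => // x y; rewrite !in_itv /= => /andP[ax _] /andP[_ yb] xy.
  by rewrite -subr_ge0 (le_trans _ (tvf _ _ ax xy yb)).
have [h ih hE] : exists2 h : R -> R, mu.-integrable setT (EFin \o h) &
    forall x y, a <= x -> x <= y -> y <= b ->
    (V \- f) y - (V \- f) x = \int[mu]_(t in `]x, y]) h t.
  apply: ac_nondecreasing_density => //; first exact: acB.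
  move=> x y; rewrite !in_itv /= => /andP[ax _] /andP[_ yb] xy.
  have := le_trans (ler_norm _) (tvf _ _ ax xy yb); lra.
exists (g \- h) => [|x y ax xy yb].
  have := integrableB measurableT ig ih; exact: eq_integrable.
rewrite RintegralB//; last 2 first.
- by apply: integrableS ig.
- by apply: integrableS ih.
by rewrite -gE// -hE//=; lra.
Qed.

(** Almost every point is a Lebesgue point of the density, and the indefinite
    integral of the density is differentiable there. *)
Theorem ac_ftc a b f : a <= b -> ac a b f ->
  exists g : R -> R, [/\ mu.-integrable setT (EFin \o g),
  forall x y, a <= x -> x <= y -> y <= b ->
    f y - f x = \int[mu]_(t in `]x, y]) g t &
  {ae mu, forall x, a < x < b -> derivable f x 1 /\ derive1 f x = g x}].
Proof.
move=> ab acf; have [g ig gE] := ac_density ab acf.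
exists g; split => //.
have := lebesgue_differentiation (open_integrable_locally openT ig).
apply: filterS; first exact: (ae_filter_ringOfSetsType mu).
move=> x gx /andP[ax xb].
have igb : mu.-integrable [set` Interval (BRight a) (BRight b)] (EFin \o g).
  by apply: integrableS ig.
have [|dF F'] := FTC1_lebesgue_pt xb igb _ gx; first by rewrite -[(_ < _)%O]/(a < x)%R.
set F := fun y : R => _ in dF F'.
have fE : \forall y \near x, (cst (f a) + F) y = f y.
  near=> y.
  have : y \in `]a, b[ by near: y; apply: near_in_itvoo; rewrite in_itv/= ax.
  rewrite in_itv /= => /andP[/ltW ay /ltW yb].
  by rewrite /F /= fctE -gE// subrKC.
have : is_derive x 1 f (g x).
  apply: near_eq_is_derive fE _; rewrite -[g x]add0r.
  by apply: is_deriveD; rewrite -F' derive1E; exact: derivableP.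
by move=> dfx; split; [exact: ex_derive|rewrite derive1E derive_val].
Unshelve. all: by end_near. Qed.

End AcDensity.

(** * Integration by parts *)

Section ByParts.
Context {R : realType}.
Implicit Types (a b c x y : R) (f g : R -> R).

Local Notation mu := (@lebesgue_measure R).

Lemma ac_bounded a b f : a <= b -> ac a b f ->
  exists2 M, 0 < M & forall x, a <= x -> x <= b -> `|f x| <= M.
Proof.
move=> ab acf; exists (`|f a| + (tv a f b - tv a f a) + 1) => [|x ax xb].
  by rewrite ltr_wpDl// addr_ge0// (le_trans _ (tv_jump acf (lexx a) ab (lexx b))).
have := tv_jump acf (lexx a) ax xb.
have := tv_jump acf ax xb (lexx b).
move=> /(le_trans (normr_ge0 _)) h1 h2.
have := ler_normD (f a) (f x - f a); rewrite subrKC; lra.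
Qed.

Lemma acM a b f g : a <= b -> ac a b f -> ac a b g -> ac a b (f \* g).
Proof.
move=> ab acf acg e e0.
have [M M0 fM] := ac_bounded ab acf; have [N N0 gN] := ac_bounded ab acg.
have eN : 0 < e / (2 * N) by rewrite divr_gt0// mulr_gt0.
have eM : 0 < e / (2 * M) by rewrite divr_gt0// mulr_gt0.
have [d d0 fd] := acf _ eN; have [d' d'0 gd'] := acg _ eM.
exists (Num.min d d'); first by rewrite lt_min d0.
move=> s sin; rewrite lt_min => /andP[sd sd'].
apply: (@le_trans _ _ (N * jumps f s + M * jumps g s)).
  rewrite /jumps !mulr_sumr -big_split big_seq [leRHS]big_seq.
  apply: ler_sum => p ps /=.
  have /andP[/allP/(_ _ ps)/and3P[ap p12 pb] _] := sin.
  have -> : f p.2 * g p.2 - f p.1 * g p.1 =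
    (f p.2 - f p.1) * g p.2 + f p.1 * (g p.2 - g p.1) by ring.
  rewrite (le_trans (ler_normD _ _))// !normrM mulrC lerD//.
    by rewrite ler_wpM2r// gN// (le_trans ap).
  by rewrite ler_wpM2r// fM// (le_trans p12).
have hf : N * jumps f s <= e / 2.
  by have := fd _ sin sd; rewrite ler_pdivlMr ?mulr_gt0// ler_pdivlMr//; lra.
have hg : M * jumps g s <= e / 2.
  by have := gd' _ sin sd'; rewrite ler_pdivlMr ?mulr_gt0// ler_pdivlMr//; lra.
lra.
Qed.

Lemma ac_sub a b x y f : a <= x -> y <= b -> ac a b f -> ac x y f.
Proof.
move=> ax yb acf e /acf[d d0 fd]; exists d => // s /andP[sin ssep] sd.
apply: fd => //; rewrite /nonoverlap_in ssep andbT.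
apply: sub_all sin => p /and3P[xp p12 py]; apply/and3P; split => //.
  exact: le_trans xp.
exact: le_trans yb.
Qed.

Lemma ac_integrable a b f : a <= b -> ac a b f ->
  mu.-integrable `[a, b] (EFin \o f).
Proof.
move=> ab acf.
have : mu.-integrable `[a, b] (EFin \o (f \o clamp a b)).
  apply: continuous_compact_integrable; first exact: segment_compact.
  exact/continuous_subspaceT/continuous_ac_clamp.
apply: eq_integrable => // x; rewrite inE /= in_itv/= => /andP[ax xb].
by rewrite clamp_id.
Qed.

Lemma ac_ae_derivable a b f : a <= b -> ac a b f ->
  {ae mu, forall x, a < x < b -> derivable f x 1}.
Proof.
move=> ab /(ac_ftc ab)[g [_ _]]; apply: filterS.
  exact: (ae_filter_ringOfSetsType mu).
by move=> x gx /gx[].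
Qed.

(** The integrand [g] stands in for the derivative of [f], which need not be
    measurable: Lebesgue measure lives here on the Borel sets and is not complete,
    so that an almost everywhere equality does not transport measurability. *)
Lemma ac_integral a b f g : a <= b -> ac a b f -> measurable_fun `]a, b[ g ->
  {ae mu, forall x, a < x < b -> derive1 f x = g x} ->
  \int[mu]_(t in `]a, b[) g t = f b - f a.
Proof.
move=> ab acf mg f'g; have [h [ih -> // f'h]] := ac_ftc ab acf.
have ih' : mu.-integrable `]a, b[ (EFin \o h) by apply: integrableS ih.
rewrite -Rintegral_itv_bndo_bndc// /Rintegral; congr fine.
apply: ae_eq_integral => //.
- exact/measurable_EFinP.
- exact: measurable_int ih'.
move: f'g f'h; apply: filterS2; first exact: (ae_filter_ringOfSetsType mu).
move=> x gx hx; rewrite /= in_itv /= => xab.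
by rewrite -gx// (hx xab).2.
Qed.

(** The fundamental theorem of calculus for the absolutely continuous function
    [(t - c) * f t]. *)
Lemma ac_by_parts a b c f : a <= b -> ac a b f ->
  mu.-integrable `]a, b[ (EFin \o derive1 f) ->
  \int[mu]_(t in `]a, b[) ((t - c) * derive1 f t) =
  (b - c) * f b - (a - c) * f a - \int[mu]_(t in `[a, b]) f t.
Proof.
move=> ab acf if'.
have mf' : measurable_fun `]a, b[ (derive1 f).
  by have /integrableP[/measurable_EFinP] := if'.
have ilin : measurable_fun `]a, b[ (fun t => t - c).
  exact: measurable_funB.
have if_ : mu.-integrable `]a, b[ (EFin \o f).
  by apply: integrableS (ac_integrable ab acf) => //; exact: subset_itv_oo_cc.
have mf : measurable_fun `]a, b[ f.
  by have /integrableP[/measurable_EFinP] := if_.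
have icf : mu.-integrable `]a, b[ (EFin \o (fun t => (t - c) * derive1 f t)).
  apply: integrableMr if' => //.
  exists (`|a - c| + `|b - c|); split; first by rewrite num_real.
  move=> M abM t /=; rewrite in_itv /= => /andP[at_ tb].
  apply: le_trans (ltW abM); rewrite ler_norml.
  have := ler_norm (a - c); have := ler_norm (b - c).
  have := ler_norm (- (a - c)); have := ler_norm (- (b - c)).
  by rewrite !normrN; lra.
have ach : ac a b ((fun t => t - c) \* f).
  apply: acM => //; apply: (@lipschitz_ac _ _ _ _ 1) => x y _ xy _.
  by rewrite mul1r ger0_norm; lra.
have := ac_integral ab ach (measurable_funD mf (measurable_funM ilin mf')).
rewrite (RintegralD _ if_ icf)//= (Rintegral_itv_bndo_bndc if_).
rewrite Rintegral_itv_obnd_cbnd; last first.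
  by apply: integrableS (ac_integrable ab acf) => //; exact: subset_itv_oc_cc.
move=> <-; first by rewrite addrC addKr.
have := ac_ae_derivable ab acf; apply: filterS.
  exact: (ae_filter_ringOfSetsType mu).
move=> x dfx /dfx{}dfx; rewrite !derive1E.
have dlin : is_derive x 1 (fun t : R => t - c) 1.
  by apply: is_derive_eq; rewrite subr0.
have dff := derivableP dfx.
rewrite [LHS](@derive_val _ _ _ _ _ _ _ (is_deriveM dlin dff)).
by rewrite /GRing.scale /= mulr1 addrC.
Qed.

End ByParts.

(** * Square integrable functions on an interval *)

Section SquareIntegrable.
Context {R : realType}.
Implicit Types (a b m : R) (f g K : R -> R) (u v : R).

Local Notation mu := (@lebesgue_measure R).

Lemma bounded_itvoo a b g B : (forall x, a < x < b -> `|g x| <= B) ->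
  [bounded g x | x in (`]a, b[%classic : set R)].
Proof.
move=> gB; exists B; split; first exact: num_real.
move=> M BM x /=; rewrite in_itv/= => /gB/le_trans; apply.
exact: ltW.
Qed.

Lemma bounded_integrable a b g B : measurable_fun `]a, b[ g ->
  (forall x, a < x < b -> `|g x| <= B) ->
  mu.-integrable `]a, b[ (EFin \o g).
Proof.
move=> mg gB; apply: measurable_bounded_integrable => //.
  by rewrite /= lebesgue_measure_itv; case: ifP => _; rewrite ltry.
exact: bounded_itvoo gB.
Qed.

Lemma L2_onP a b g : L2_on a b g <->
  measurable_fun `]a, b[ g /\
  mu.-integrable `]a, b[ (EFin \o (fun x => g x ^+ 2)).
Proof.
have sqrE : EFin \o (fun x => (g \_ `]a, b[) x ^+ 2) =
    (EFin \o (fun x => g x ^+ 2)) \_ `]a, b[.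
  apply/funext => x /=; rewrite !patchE; case: ifPn => //= _.
  by rewrite expr0n.
have mkcond := @integrable_mkcond _ _ _ mu `]a, b[%classic
  (EFin \o (fun x => g x ^+ 2)) (measurable_itv _).
split=> [gL2|[mg ig]].
  split.
    apply/(measurable_restrictT _ _).2 => //.
    by have /andP[/[!inE]] := gL2.
  have := Lfun2_integrable_sqr gL2; rewrite sqrE => i.
  exact: mkcond.2.
rewrite /L2_on; apply/andP; split; rewrite inE/=.
  exact/(measurable_restrictT _ _).1.
rewrite /finite_norm unlock poweR_lty//.
have : mu.-integrable setT (EFin \o (fun x => (g \_ `]a, b[) x ^+ 2)).
  by rewrite sqrE; exact: mkcond.1.
move=> /integrableP[_]; apply: le_lt_trans; rewrite le_eqVlt; apply/orP; left.
apply/eqP/eq_integral => x _ /=.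
by rewrite powR_mulrn// normrX.
Qed.

(** On a bounded interval, [1 + g ^+ 2] dominates [g]. *)
Lemma sqr_integrable a b g : measurable_fun `]a, b[ g ->
  mu.-integrable `]a, b[ (EFin \o (fun x => g x ^+ 2)) ->
  mu.-integrable `]a, b[ (EFin \o g).
Proof.
move=> mg ig2.
have i1 : mu.-integrable `]a, b[ (EFin \o (fun=> 1 : R)).
  by apply: (@bounded_integrable _ _ _ 1) => // x _; rewrite normr1.
apply: le_integrable (integrableD _ i1 ig2) => //.
  exact/measurable_EFinP.
move=> x _ /=; rewrite lee_fin [leRHS]ger0_norm ?addr_ge0 ?sqr_ge0//.
have := sqr_ge0 (`|g x| - 1); rewrite -(real_normK (num_real (g x))).
rewrite sqrrB1; have := normr_ge0 (g x); nra.
Qed.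

Lemma Rintegral_lincomb a b f g u v :
  mu.-integrable `]a, b[ (EFin \o f) -> mu.-integrable `]a, b[ (EFin \o g) ->
  mu.-integrable `]a, b[ (EFin \o (fun x => u * f x + v * g x)) /\
  \int[mu]_(x in `]a, b[) (u * f x + v * g x) =
  u * (\int[mu]_(x in `]a, b[) f x) + v * (\int[mu]_(x in `]a, b[) g x).
Proof.
move=> if_ ig.
have mD : measurable (`]a, b[%classic : set (measurableTypeR R)).
  exact: measurable_itv.
have iuf : mu.-integrable `]a, b[ (EFin \o (fun x => u * f x)).
  by have := integrableZl mD u if_; apply: eq_integrable.
have ivg : mu.-integrable `]a, b[ (EFin \o (fun x => v * g x)).
  by have := integrableZl mD v ig; apply: eq_integrable.
split; first by have := integrableD mD iuf ivg; apply: eq_integrable.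
by rewrite RintegralD// !RintegralZl.
Qed.

(** Cauchy-Schwarz inequality for [K] and [g] minus its mean value [E]; the
    hypothesis that [K] has integral zero makes the mean value disappear from the
    left-hand side. The integral of [(g - E - l * K) ^+ 2] is a nonnegative
    polynomial of degree at most 2 in [l]; if [S != 0], its minimum is reached at
    [Kg / S]. *)
Lemma centered_cauchy_schwarz a b g K : a < b ->
  measurable_fun `]a, b[ g ->
  mu.-integrable `]a, b[ (EFin \o (fun x => g x ^+ 2)) ->
  measurable_fun `]a, b[ K ->
  (exists B, forall x, a < x < b -> `|K x| <= B) ->
  \int[mu]_(x in `]a, b[) K x = 0 ->
  (\int[mu]_(x in `]a, b[) (K x * g x)) ^+ 2 <=
  (\int[mu]_(x in `]a, b[) (K x ^+ 2)) * ((b - a) * T_diag g a b).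
Proof.
move=> ab mg ig2 mK [B KB] K0.
have ig := sqr_integrable mg ig2.
have iK := bounded_integrable mK KB.
have i1 : mu.-integrable `]a, b[ (EFin \o (fun=> 1 : R)).
  by apply: (@bounded_integrable _ _ _ 1) => // x _; rewrite normr1.
have iK2 : mu.-integrable `]a, b[ (EFin \o (fun x => K x ^+ 2)).
  apply: (@bounded_integrable _ _ _ (B ^+ 2)) => [|x /KB KxB].
    exact: measurable_funX.
  by rewrite normrX lerXn2r// nnegrE// (le_trans _ KxB).
have iKg : mu.-integrable `]a, b[ (EFin \o (fun x => K x * g x)).
  by apply: integrableMr ig => //; exact: bounded_itvoo KB.
set Kg := \int[mu]_(x in _) (K x * g x); set S := \int[mu]_(x in _) (K x ^+ 2).
set h := b - a; have h0 : 0 < h by rewrite subr_gt0.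
have I1 : \int[mu]_(x in `]a, b[) (1 : R) = h.
  rewrite Rintegral_cst// mul1r.
  by rewrite [X in fine X]lebesgue_measure_itv /= lte_fin ab.
pose E := h^-1 * \int[mu]_(x in `]a, b[) g x.
pose A2 := \int[mu]_(x in `]a, b[) (g x ^+ 2).
have TE : T_diag g a b = h^-1 * A2 - E ^+ 2 by [].
have quad l : 0 <= h * T_diag g a b - 2 * l * Kg + l ^+ 2 * S.
  have [i2 I2] := Rintegral_lincomb 1 (- (2 * E)) ig2 ig.
  have [i3 I3] := Rintegral_lincomb (E ^+ 2) (2 * l * E) i1 iK.
  have [i4 I4] := Rintegral_lincomb (l ^+ 2) (- (2 * l)) iK2 iKg.
  have [i5 I5] := Rintegral_lincomb 1 1 i2 i3.
  have [i6 I6] := Rintegral_lincomb 1 1 i5 i4.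
  suff -> : h * T_diag g a b - 2 * l * Kg + l ^+ 2 * S =
    \int[mu]_(x in `]a, b[) ((g x - E - l * K x) ^+ 2).
    by apply: Rintegral_ge0 => x _; exact: sqr_ge0.
  transitivity (\int[mu]_(x in `]a, b[)
    (1 * (1 * (1 * g x ^+ 2 + - (2 * E) * g x) + 1 * (E ^+ 2 * 1 + 2 * l * E * K x))
     + 1 * (l ^+ 2 * K x ^+ 2 + - (2 * l) * (K x * g x)))).
    rewrite I6 I5 I2 I3 I4 K0 I1 -/Kg -/S -/A2 TE.
    have -> : \int[mu]_(x in `]a, b[) g x = h * E.
      by rewrite /E mulrA divff ?mul1r// gt_eqF.
    by field; rewrite gt_eqF.
  by apply: eq_Rintegral => x _; ring.
have S0 : 0 <= S by apply: Rintegral_ge0 => x _; exact: sqr_ge0.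
have [S_eq0|S_neq0] := eqVneq S 0.
  suff -> : Kg = 0 by rewrite S_eq0 mul0r expr0n.
  (* The polynomial is affine in l; unless Kg = 0, it is -1 at the chosen l. *)
  have := quad ((h * T_diag g a b + 1) / (2 * Kg)); rewrite S_eq0 mulr0 addr0.
  have [//|Kg0] := eqVneq Kg 0.
  have -> : 2 * ((h * T_diag g a b + 1) / (2 * Kg)) * Kg = h * T_diag g a b + 1.
    by field.
  lra.
have := quad (Kg / S).
have -> : h * T_diag g a b - 2 * (Kg / S) * Kg + (Kg / S) ^+ 2 * S =
   h * T_diag g a b - Kg ^+ 2 / S by field.
by rewrite subr_ge0 ler_pdivrMr ?lt_def ?S_neq0// mulrC.
Qed.

End SquareIntegrable.

(** * The Peano kernel of the quadrature rule *)

Section Kernel.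
Context {R : realType}.
Implicit Types (a b c m t : R) (f g : R -> R) (n : nat).

Local Notation mu := (@lebesgue_measure R).

Lemma Rintegral_split a m b g : a < m -> m < b ->
  mu.-integrable `]a, b[ (EFin \o g) ->
  \int[mu]_(t in `]a, b[) g t =
  \int[mu]_(t in `]a, m[) g t + \int[mu]_(t in `]m, b[) g t.
Proof.
move=> am mb ig; have le1 : (BRight a <= BRight m)%O by rewrite bnd_simp ltW.
have le2 : (BRight m <= BLeft b)%O by rewrite bnd_simp.
rewrite -(Rintegral_itvB ig le1 le2) (Rintegral_itv_bndo_bndc (r := m)); last first.
  by apply: integrableS ig => //; apply: subset_itvl; rewrite bnd_simp ltW.
by rewrite subrKC.
Qed.

Lemma is_derive_power (x c : R) n :
  is_derive x 1 (fun t : R => (t - c) ^+ n.+1 / n.+1%:R) ((x - c) ^+ n).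
Proof.
have d1 : is_derive x 1 (fun t : R => t - c) 1.
  by apply: is_derive_eq; rewrite subr0.
have := is_deriveZ n.+1%:R^-1 (is_deriveX n.+1 d1).
rewrite /GRing.scale /= mulr1 mulrA mulVf ?pnatr_eq0// mul1r.
congr is_derive; apply/funext => t; rewrite exprfctE /GRing.scale /=.
by rewrite mulrC.
Qed.

Lemma integral_power a b c n : a <= b ->
  \int[mu]_(t in `]a, b[) ((t - c) ^+ n) =
  ((b - c) ^+ n.+1 - (a - c) ^+ n.+1) / n.+1%:R.
Proof.
move=> ab; pose f := fun t => (t - c) ^+ n.+1 / n.+1%:R.
have acl : ac a b (fun t => t - c).
  by apply: (@lipschitz_ac _ _ _ _ 1) => x y _ xy _; rewrite mul1r ger0_norm; lra.
have acX p : ac a b (fun t => (t - c) ^+ p).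
  elim: p => [|p IHp].
    by apply: (@lipschitz_ac _ _ _ _ 0) => x y _ _ _; rewrite !expr0 subrr normr0 mul0r.
  have := acM ab acl IHp; congr ac; apply/funext => t /=; by rewrite exprS.
have acf : ac a b f.
  apply: (acM ab (acX n.+1) (g := fun=> n.+1%:R^-1)).
  by apply: (@lipschitz_ac _ _ _ _ 0) => x y _ _ _; rewrite subrr normr0 mul0r.
rewrite (ac_integral ab acf) ?/f ?mulrBl//.
  by apply: measurable_funX; exact: measurable_funB.
apply: aeW => x _; rewrite derive1E.
by have ? := is_derive_power x c n; rewrite derive_val.
Qed.

Definition midpoint a b := (a + b) / 2.

(** The zeros of the kernel are at distance [kernel_shift a b] from the midpoint,
    that is, at distance [Num.sqrt 2 / 8 * (b - a)] from the endpoints: this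
    distance is the weight of the endpoints in the rule. *)
Definition kernel_shift a b := (1 / 2 - Num.sqrt 2 / 8) * (b - a).

Definition peano_kernel a b t :=
  if t < midpoint a b then t - midpoint a b + kernel_shift a b
  else t - midpoint a b - kernel_shift a b.

Lemma peano_kernelL a b t : t < midpoint a b ->
  peano_kernel a b t = t - (midpoint a b - kernel_shift a b).
Proof. by move=> tm; rewrite /peano_kernel tm opprB addrA addrAC. Qed.

Lemma peano_kernelR a b t : midpoint a b <= t ->
  peano_kernel a b t = t - (midpoint a b + kernel_shift a b).
Proof. by move=> mt; rewrite /peano_kernel ltNge mt opprD addrA. Qed.

Lemma measurable_peano_kernel a b (D : set R) : measurable_fun D (peano_kernel a b).
Proof.
apply: (@measurable_funS _ _ _ _ setT) => //.
apply: measurable_fun_ifT.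
- by apply: measurable_fun_ltr.
- by apply: measurable_funD => //; exact: measurable_funB.
- by apply: measurable_funB => //; exact: measurable_funB.
Qed.

Variables a b : R.
Hypothesis ab : a < b.

Local Notation m := (midpoint a b).
Local Notation k := (kernel_shift a b).
Local Notation K := (peano_kernel a b).

Lemma lt_midpoint : a < m /\ m < b.
Proof. by move: ab; rewrite /midpoint => ab'; split; lra. Qed.

Lemma peano_kernel_bounded t : a < t < b -> `|K t| <= (b - a) + `|k|.
Proof.
move=> /andP[at_ tb]; have [am mb] := lt_midpoint.
have k1 := ler_norm k; have k2 := ler_norm (- k); rewrite normrN in k2.
rewrite ler_norml /peano_kernel; set l := `|k| in k1 k2 *.
by case: ifPn => _; apply/andP; split; lra.
Qed.

Lemma peano_kernelM_split g : mu.-integrable `]a, b[ (EFin \o g) ->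
  \int[mu]_(t in `]a, b[) (K t * g t) =
  \int[mu]_(t in `]a, m[) ((t - (m - k)) * g t) +
  \int[mu]_(t in `]m, b[) ((t - (m + k)) * g t).
Proof.
move=> ig; have [am mb] := lt_midpoint; rewrite (Rintegral_split am mb); last first.
  apply: integrableMr ig => //; first exact: measurable_peano_kernel.
  exact: bounded_itvoo peano_kernel_bounded.
congr (_ + _); apply: eq_Rintegral => t; rewrite inE /= in_itv /= => /andP[ht ht'].
  by rewrite peano_kernelL.
by rewrite peano_kernelR// ltW.
Qed.

Lemma integral_peano_kernel : \int[mu]_(t in `]a, b[) K t = 0.
Proof.
have [am mb] := lt_midpoint.
have i1 : mu.-integrable `]a, b[ (EFin \o (fun=> 1 : R)).
  by apply: (@bounded_integrable _ _ _ _ 1) => // x _; rewrite normr1.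
transitivity (\int[mu]_(t in `]a, b[) (K t * 1)).
  by apply: eq_Rintegral => t _; rewrite mulr1.
rewrite peano_kernelM_split//.
have E x y c : x <= y -> \int[mu]_(t in `]x, y[) ((t - c) * 1) =
   ((y - c) ^+ 2 - (x - c) ^+ 2) / 2.
  move=> xy; rewrite -(integral_power c 1 xy); apply: eq_Rintegral => t _.
  by rewrite mulr1 expr1.
by rewrite !E ?ltW// /midpoint; field.
Qed.

(** With [c = Num.sqrt 2 / 8] and [b - a = 1], the four cubes add up to
    [2 / 3 * ((1 / 2 - c) ^+ 3 + c ^+ 3) = 1 / 12 - c / 2 + c ^+ 2], and
    [c ^+ 2 = 1 / 32]. *)
Lemma integral_peano_kernel_sqr : \int[mu]_(t in `]a, b[) (K t ^+ 2) =
  (11 / 96 - Num.sqrt 2 / 16) * (b - a) ^+ 3.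
Proof.
have [am mb] := lt_midpoint.
have iK2 : mu.-integrable `]a, b[ (EFin \o (fun t => K t ^+ 2)).
  apply: (@bounded_integrable _ _ _ _ ((b - a + `|k|) ^+ 2)).
    by apply: measurable_funX; exact: measurable_peano_kernel.
  move=> t /peano_kernel_bounded Kt.
  by rewrite normrX lerXn2r// nnegrE// (le_trans _ Kt).
rewrite (Rintegral_split am mb iK2).
have -> : \int[mu]_(t in `]a, m[) (K t ^+ 2) =
    \int[mu]_(t in `]a, m[) ((t - (m - k)) ^+ 2).
  apply: eq_Rintegral => t.
  by rewrite inE /= in_itv /= => /andP[_ tm]; rewrite peano_kernelL.
have -> : \int[mu]_(t in `]m, b[) (K t ^+ 2) =
    \int[mu]_(t in `]m, b[) ((t - (m + k)) ^+ 2).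
  apply: eq_Rintegral => t.
  by rewrite inE /= in_itv /= => /andP[tm _]; rewrite peano_kernelR// ltW.
rewrite (integral_power _ 2 (ltW am)).
rewrite (integral_power _ 2 (ltW mb)) /kernel_shift /midpoint.
have s2 : Num.sqrt 2 ^+ 2 = 2 :> R by rewrite sqr_sqrtr.
set s := Num.sqrt 2 in s2 *.
apply/eqP; rewrite -subr_eq0; apply/eqP.
transitivity ((s ^+ 2 - 2) * ((b - a) ^+ 3 / 64)); first by field.
by rewrite s2 subrr mul0r.
Qed.

(** Integration by parts on each half of [a, b]: the boundary terms at [a], [b] and,
    from both sides, at the midpoint are exactly the terms of the quadrature rule. *)
Lemma Q_kernel f : ac a b f -> mu.-integrable `]a, b[ (EFin \o derive1 f) ->
  Q f a b = - \int[mu]_(t in `]a, b[) (K t * derive1 f t).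
Proof.
move=> acf if'; have [am mb] := lt_midpoint.
rewrite peano_kernelM_split//.
rewrite (ac_by_parts _ (ltW am)); last 2 first.
- by apply: ac_sub acf => //; exact: ltW.
- by apply: integrableS if' => //; apply: subset_itvl; rewrite bnd_simp ltW.
rewrite (ac_by_parts _ (ltW mb)); last 2 first.
- by apply: ac_sub acf => //; exact: ltW.
- by apply: integrableS if' => //; apply: subset_itvr; rewrite bnd_simp ltW.
rewrite /Q -/(midpoint a b).
have iab := ac_integrable (ltW ab) acf.
have := Rintegral_itvB (a := BLeft a) (b := BRight b) (x := m) iab.
rewrite !bnd_simp !ltW// => /(_ isT isT).
rewrite (Rintegral_itv_obnd_cbnd (r := m)); last first.
  by apply: integrableS iab => //; apply: subset_itvr; rewrite bnd_simp ltW.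
move=> /eqP; rewrite subr_eq => /eqP ->.
by rewrite /kernel_shift /midpoint; field.
Qed.
End Kernel.

(** * The extremal function *)

Section Extremal.
Context {R : realType}.
Implicit Types (x y t : R).

Variables a b : R.
Hypothesis ab : a < b.

Local Notation m := (midpoint a b).
Local Notation k := (kernel_shift a b).
Local Notation K := (peano_kernel a b).

(** A primitive of the Peano kernel: it turns the Cauchy-Schwarz inequality into an
    equality. Both quadratic pieces take the value [k ^+ 2 / 2] at the midpoint, so
    the jump of the kernel only produces a corner. *)
Definition extremal t := (`|t - m| - k) ^+ 2 / 2.

Lemma extremal_abs_continuous : abs_continuous a b extremal.
Proof.
apply: (@lipschitz_abs_continuous _ _ _ _ ((b - a) + `|k|)) => x y ax xy yb.
have [am mb] := lt_midpoint ab.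
have -> : extremal y - extremal x =
  (`|y - m| - `|x - m|) * ((`|y - m| + `|x - m|) / 2 - k).
  by rewrite /extremal; field.
rewrite normrM mulrC ler_pM//.
  have k1 := ler_norm k; have k2 := ler_norm (- k); rewrite normrN in k2.
  have hx : `|x - m| <= b - a by rewrite ler_norml; apply/andP; split; lra.
  have hy : `|y - m| <= b - a by rewrite ler_norml; apply/andP; split; lra.
  have := normr_ge0 (x - m); have := normr_ge0 (y - m) => y0 x0.
  by rewrite ler_norml; apply/andP; split; lra.
have := ler_dist_dist (y - m) (x - m).
have -> : y - m - (x - m) = y - x by ring.
by rewrite (ger0_norm (_ : 0 <= y - x)) ?subr_ge0.
Qed.

Lemma derive_extremal t : t != m -> derive1 extremal t = K t.
Proof.
move=> tm; rewrite derive1E.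
have [tm'|mt] := ltP t m.
  rewrite peano_kernelL// -[RHS]expr1.
  suff : is_derive t 1 extremal ((t - (m - k)) ^+ 1) by move=> ?; exact: derive_val.
  apply: near_eq_is_derive (is_derive_power _ _ _).
  near=> x; have xm : x < m by near: x; exact: lt_nbhsl.
  by rewrite /extremal ltr0_norm ?subr_lt0//; congr (_ / _); ring.
have {tm mt}mt : m < t by rewrite lt_def tm.
rewrite peano_kernelR ?(ltW mt)// -[RHS]expr1.
suff : is_derive t 1 extremal ((t - (m + k)) ^+ 1) by move=> ?; exact: derive_val.
apply: near_eq_is_derive (is_derive_power _ _ _).
near=> x; have mx : m < x by near: x; exact: lt_nbhsr.
by rewrite /extremal gtr0_norm ?subr_gt0//; congr (_ / _); ring.
Unshelve. all: by end_near. Qed.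

End Extremal.

Section Sharpness.
Context {R : realType}.
Variables a b : R.
Hypothesis ab : a < b.

Local Notation mu := (@lebesgue_measure R).
Local Notation m := (midpoint a b).
Local Notation K := (peano_kernel a b).
Local Notation F' := (derive1 (extremal a b)).

Lemma sharp_constant_gt0 : 0 < 11 / 96 - Num.sqrt 2 / 16 :> R.
Proof.
have s0 : 0 <= Num.sqrt 2 :> R by exact: sqrtr_ge0.
have s2 : Num.sqrt 2 ^+ 2 = 2 :> R by rewrite sqr_sqrtr.
nra.
Qed.

Lemma powR_three_halves (h : R) : 0 <= h -> h `^ (3 / 2) = Num.sqrt (h ^+ 3).
Proof. by move=> h0; rewrite powRrM powR12_sqrt ?powR_ge0// powR_mulrn. Qed.

Lemma measurable_derive_extremal : measurable_fun `]a, b[ F'.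
Proof.
have -> : F' = fun t => if t == m then F' m else K t.
  by apply/funext => t; case: eqP => [->//|/eqP/derive_extremal].
apply: (@measurable_funS _ _ _ _ setT) => //.
apply: measurable_fun_ifT => //; last exact: measurable_peano_kernel.
by apply: measurable_fun_eqr.
Qed.

(** The derivative of the extremal function equals the kernel except at the
    midpoint, and a single point is a null set. *)
Lemma integral_derive_extremal (G : R -> R -> R) :
  measurable_fun `]a, b[ (fun t => G t (F' t)) ->
  measurable_fun `]a, b[ (fun t => G t (K t)) ->
  \int[mu]_(t in `]a, b[) G t (F' t) = \int[mu]_(t in `]a, b[) G t (K t).
Proof.
move=> mF mK; rewrite /Rintegral; congr fine; apply: ae_eq_integral => //.
- exact/measurable_EFinP.
- exact/measurable_EFinP.
exists [set m]; split => //; first exact: lebesgue_measure_set1.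
move=> t /= tP; apply: contrapT => /eqP tm; apply: tP => _.
by rewrite derive_extremal.
Qed.

Lemma L2_derive_extremal : L2_on a b F'.
Proof.
apply/L2_onP; split; first exact: measurable_derive_extremal.
apply: (@bounded_integrable _ _ _ _ (((b - a) + `|kernel_shift a b|) ^+ 2 + F' m ^+ 2)).
  by apply: measurable_funX; exact: measurable_derive_extremal.
move=> t atb; rewrite ger0_norm ?sqr_ge0//.
have [->|tm] := eqVneq t m; first by rewrite lerDr sqr_ge0.
rewrite derive_extremal// (le_trans _ (ler_wpDr (sqr_ge0 _) (lexx _)))//.
have := peano_kernel_bounded ab atb => Kt; rewrite -(real_normK (num_real (K t))).
by rewrite lerXn2r// nnegrE// (le_trans _ Kt).
Qed.

End Sharpness.

(** * The inequality and its sharpness *)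

Section Inequality.
Context {R : realType}.
Implicit Types (a b : R) (f : R -> R).

Lemma Q_le a b f : a < b -> abs_continuous a b f -> L2_on a b (derive1 f) ->
  `|Q f a b| <= Num.sqrt (11 / 96 - Num.sqrt 2 / 16)
                   * sigma (derive1 f) a b * (b - a) `^ (3 / 2).
Proof.
move=> ab /abs_continuous_ac acf /L2_onP[mf' if'2].
have h0 : 0 <= b - a by rewrite subr_ge0 ltW.
have S0 : 0 <= 11 / 96 - Num.sqrt 2 / 16 :> R := ltW sharp_constant_gt0.
rewrite (Q_kernel ab acf (sqr_integrable mf' if'2)) normrN -sqrtr_sqr.
rewrite /sigma (powR_three_halves h0) mulrAC -(sqrtrM _ S0).
rewrite -sqrtrM ?mulr_ge0 ?exprn_ge0//; apply: ler_wsqrtr.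
rewrite -(integral_peano_kernel_sqr ab).
apply: centered_cauchy_schwarz => //; first exact: measurable_peano_kernel.
  by exists (b - a + `|kernel_shift a b|); exact: peano_kernel_bounded.
exact: integral_peano_kernel.
Qed.

(** As the derivative of the extremal function is the kernel almost everywhere, the
    left-hand side is the integral of the squared kernel, that is [s ^+ 2 * P ^+ 2]
    with [s] the sharp constant and [P] equal to [(b - a) `^ (3 / 2)], while the
    right-hand side is [C * (s * P) * P]. *)
Lemma Q_extremal_le a b (C : R) : a < b ->
  `|Q (extremal a b) a b| <=
    C * sigma (derive1 (extremal a b)) a b * (b - a) `^ (3 / 2) ->
  Num.sqrt (11 / 96 - Num.sqrt 2 / 16) <= C.
Proof.
move=> ab; have h0 : 0 < b - a by rewrite subr_gt0.
have mF : measurable_fun `]a, b[ (derive1 (extremal a b)).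
  exact: measurable_derive_extremal.
have mK := @measurable_peano_kernel _ a b `]a, b[%classic.
have /L2_onP[_ iF2] := L2_derive_extremal ab.
have acF := abs_continuous_ac (extremal_abs_continuous ab).
rewrite (Q_kernel ab acF (sqr_integrable mF iF2)) normrN.
rewrite (integral_derive_extremal (G := fun t y => peano_kernel a b t * y)); last 2 first.
- exact: measurable_funM.
- exact: measurable_funM.
rewrite /sigma /T_diag.
rewrite (integral_derive_extremal (G := fun _ y => y ^+ 2)); last 2 first.
- exact: measurable_funX.
- exact: measurable_funX.
rewrite (integral_derive_extremal (G := fun _ y => y))//.
rewrite (integral_peano_kernel ab) mulr0 expr0n subr0 mulrA divff ?gt_eqF// mul1r.
have -> : \int[lebesgue_measure]_(t in `]a, b[) (peano_kernel a b t * peano_kernel a b t) =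
    \int[lebesgue_measure]_(t in `]a, b[) (peano_kernel a b t ^+ 2).
  by apply: eq_Rintegral => t _; rewrite expr2.
rewrite (integral_peano_kernel_sqr ab) (powR_three_halves (ltW h0)).
set S : R := (11 / 96 - _); have S0 : 0 < S by exact: sharp_constant_gt0.
have h30 : 0 < (b - a) ^+ 3 by rewrite exprn_gt0.
rewrite (ger0_norm (ltW (mulr_gt0 S0 h30))) (sqrtrM _ (ltW S0)).
rewrite -{1}(sqr_sqrtr (ltW S0)) -{1}(sqr_sqrtr (ltW h30)).
have : 0 < Num.sqrt S by rewrite sqrtr_gt0.
have : 0 < Num.sqrt ((b - a) ^+ 3) by rewrite sqrtr_gt0.
move: (Num.sqrt (_ ^+ 3)) (Num.sqrt S) => P s P0 s0.
have -> : s ^+ 2 * P ^+ 2 = s * (s * P * P) by ring.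
have -> : C * (s * P) * P = C * (s * P * P) by ring.
by rewrite ler_pM2r// !mulr_gt0.
Qed.

End Inequality.

Unset Implicit Arguments.

Theorem theorem11 (R : realType) (a b : R) (hab : a < b) :
  (forall f : R -> R, abs_continuous a b f -> L2_on a b (derive1 f) ->
     `|Q f a b| <= Num.sqrt (11 / 96 - Num.sqrt 2 / 16)
                   * sigma (derive1 f) a b * (b - a) `^ (3 / 2))
  /\
  (forall C : R,
     (forall f : R -> R, abs_continuous a b f -> L2_on a b (derive1 f) ->
        `|Q f a b| <= C * sigma (derive1 f) a b * (b - a) `^ (3 / 2)) ->
     Num.sqrt (11 / 96 - Num.sqrt 2 / 16) <= C).
Proof.
split=> [f|C CQ]; first exact: Q_le.
apply: (Q_extremal_le hab); apply: CQ.
  exact: extremal_abs_continuous.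
exact: L2_derive_extremal.
Qed.
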